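(* Let $X$ and $Y$ be Banach spaces, and let $S\in L(X,Y)$ and $T\in L(Y,X)$ be regular operators such that $R(ST)$ and $R(TS)$ are finite dimensional. Let $S'\in L(Y,X)$ and $T'\in L(X,Y)$ be generalized inverses for $S$ and $T$ respectively. Then $(S,T)\in RP(X,Y)$ if and only if, for every Banach space $Z$, the operators $$\tilde L_{S'}\tilde L_S+\tilde L_T\tilde L_{T'}\in L(C(Z,X))\quad\text{and}\quad \tilde L_{T'}\tilde L_T+\tilde L_S\tilde L_{S'}\in L(C(Z,Y))$$ are invertible. Similarly, $(S,T)\in RP(X,Y)$ if and only if, for every Banach space $Z$, the operators $$\tilde R_{S'}\tilde R_S+\tilde R_T\tilde R_{T'}\in L(C(Y,Z))\quad\text{and}\quad \tilde R_{T'}\tilde R_T+\tilde R_S\tilde R_{S'}\in L(C(X,Z))$$ are invertible.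
   Context: $L(X,Y)$ is the space of bounded linear operators from $X$ to $Y$ ($L(X)=L(X,X)$), $K(X,Y)$ the closed subspace of compact operators, and $C(X,Y)=L(X,Y)/K(X,Y)$ (a Banach space); $N(\cdot)$ and $R(\cdot)$ denote null space and range. For $S\in L(X,Y)$, $T\in L(Y,X)$, the pair $(S,T)$ is a Fredholm pair if $N(S)/(N(S)\cap R(T))$, $R(T)/(N(S)\cap R(T))$, $N(T)/(N(T)\cap R(S))$, $R(S)/(N(T)\cap R(S))$ are all finite dimensional. An operator $T\in L(Y,X)$ is regular if $T=TT'T$ for some $T'\in L(X,Y)$; such a $T'$ is called a generalized inverse for $T$. $RP(X,Y)$ is the set of Fredholm pairs with both operators regular. Multiplication operators. For any Banach spaces $E,F,Z$ and $A\in L(E,F)$, $\tilde L_A\colon C(Z,E)\to C(Z,F)$ is the operator induced on the quotients by $V\mapsto AV$ $(V\in L(Z,E))$, and $\tilde R_A\colon C(F,Z)\to C(E,Z)$ is the operator induced by $W\mapsto WA$ $(W\in L(F,Z))$. *)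

(* Defs.v *)
From HB Require Import structures.
From mathcomp Require Import all_boot all_order all_algebra.
From mathcomp Require Import generic_quotient ring_quotient.
From mathcomp Require Import complex.
From mathcomp Require finmap.
From mathcomp Require Import all_classical all_reals all_analysis.

Set Implicit Arguments.
Unset Strict Implicit.
Unset Printing Implicit Defensive.

Import Order.TTheory GRing.Theory Num.Theory.
Import numFieldNormedType.Exports.

Local Open Scope classical_set_scope.
Local Open Scope ring_scope.

(* Banach spaces are taken over the reals or over the complex numbers; every
   definition below covers both cases. *)
Inductive scalar_kind := RealScalars | ComplexScalars.

Definition scalar_field (R : realType) (k : scalar_kind) : numFieldType :=
  match k with
  | RealScalars => R
  | ComplexScalars => R[i]
  end.

(* In MathComp-Analysis the norm of a space over R[i] takes its values in R[i];
   suprema and infima of norms are computed in R through these two maps. *)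
Definition scalar_re (R : realType) (k : scalar_kind) : scalar_field R k -> R :=
  match k with
  | RealScalars => id
  | ComplexScalars => @complex.Re R
  end.

Definition scalar_of (R : realType) (k : scalar_kind) : R -> scalar_field R k :=
  match k with
  | RealScalars => id
  | ComplexScalars => real_complex R
  end.

Section scalars.
Variables (R : realType) (k : scalar_kind).
Local Notation K := (scalar_field R k).
Local Notation re := (@scalar_re R k).
Local Notation of_re := (@scalar_of R k).

Lemma scalar_ofK : cancel of_re re.
Proof. by case: k. Qed.

Lemma scalar_ofD x y : of_re (x + y) = of_re x + of_re y.
Proof. by case: k => //=; rewrite rmorphD. Qed.

Lemma scalar_ofM x y : of_re (x * y) = of_re x * of_re y.
Proof. by case: k => //=; rewrite rmorphM. Qed.

Lemma scalar_of0 : of_re 0 = 0.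
Proof. by case: k => //=. Qed.

Lemma scalar_of1 : of_re 1 = 1.
Proof. by case: k => //=. Qed.

Lemma ler_scalar_of x y : (of_re x <= of_re y) = (x <= y).
Proof. by case: k => //=; rewrite lecR. Qed.

Lemma ltr_scalar_of x y : (of_re x < of_re y) = (x < y).
Proof. by case: k => //=; rewrite ltcR. Qed.

Lemma scalar_reK (x : K) : 0 <= x -> of_re (re x) = x.
Proof.
case: k x => //= -[a b]; rewrite lecE /= => /andP[/eqP b0 _].
by rewrite b0.
Qed.

Lemma scalar_re_ge0 (x : K) : 0 <= x -> 0 <= re x.
Proof. by move=> x0; rewrite -ler_scalar_of scalar_of0 scalar_reK. Qed.

Lemma scalar_re_gt0 (x : K) : 0 < x -> 0 < re x.
Proof. by move=> x0; rewrite -ltr_scalar_of scalar_of0 scalar_reK// ltW. Qed.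

Lemma ler_scalar_re (x y : K) : 0 <= x -> 0 <= y -> (re x <= re y) = (x <= y).
Proof. by move=> x0 y0; rewrite -ler_scalar_of !scalar_reK. Qed.

End scalars.

Section bounded_linear_predicate.
Variables (K : numFieldType) (X Y : normedModType K).

Definition bounded_linear : {pred X -> Y} :=
  [pred f | `[< linear f /\ exists M : K, forall x, `|f x| <= M * `|x| >]].

Lemma bounded_linearP (f : X -> Y) :
  reflect (linear f /\ exists M : K, forall x, `|f x| <= M * `|x|)
          (f \in bounded_linear).
Proof. exact: asboolP. Qed.

Lemma bounded_linear_submod_closed : submod_closed bounded_linear.
Proof.
split=> [|a f g].
  apply/bounded_linearP; split; first by move=> a x y; rewrite /= scaler0 addr0.
  by exists 0 => x; rewrite /= normr0 mul0r.
move=> /bounded_linearP[lf [M fM]] /bounded_linearP[lg [N gN]].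
have afgE z : (a *: f + g) z = a *: f z + g z by [].
apply/bounded_linearP; split.
  move=> c x y; rewrite !afgE lf lg !scalerDr !scalerA [a * c]mulrC -!addrA.
  by congr (_ + _); rewrite addrCA.
exists (`|a| * M + N) => x; rewrite afgE mulrDl.
by rewrite (le_trans (ler_normD _ _))// lerD// normrZ -mulrA ler_wpM2l.
Qed.

HB.instance Definition _ :=
  GRing.isSubmodClosed.Build K (X -> Y) bounded_linear
    bounded_linear_submod_closed.

Record blop := Blop {
  blop_fun :> X -> Y;
  blop_funP : blop_fun \in bounded_linear }.

HB.instance Definition _ := [isSub for blop_fun].
HB.instance Definition _ := [Choice of blop by <:].
HB.instance Definition _ := [SubChoice_isSubLmodule of blop by <:].

Lemma blop_linear (f : blop) : linear f.
Proof. by have /bounded_linearP[] := blop_funP f. Qed.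

HB.instance Definition _ (f : blop) :=
  GRing.isLinear.Build K X Y *:%R f (@blop_linear f).

Lemma blopP (f g : blop) : f =1 g -> f = g.
Proof. by move=> fg; apply/val_inj/funext. Qed.

Lemma blopD (f g : blop) x : (f + g) x = f x + g x. Proof. by []. Qed.

Lemma blopN (f : blop) x : (- f) x = - f x. Proof. by []. Qed.

Lemma blopB (f g : blop) x : (f - g) x = f x - g x. Proof. by []. Qed.

Lemma blopZ a (f : blop) x : (a *: f) x = a *: f x. Proof. by []. Qed.

Lemma blop0 x : (0 : blop) x = 0. Proof. by []. Qed.

Lemma blop_bounded (f : blop) : exists2 M : K, 0 <= M &
  forall x, `|f x| <= M * `|x|.
Proof.
have /bounded_linearP[_ [M fM]] := blop_funP f.
exists `|M| => // x; have := fM x.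
suff -> : M * `|x| = `|M| * `|x| by [].
by rewrite -{2}(normr_id x) -normrM ger0_norm// (le_trans _ (fM x)).
Qed.

End bounded_linear_predicate.

Arguments bounded_linear {K} X Y.

Section composition.
Variable K : numFieldType.

Lemma blop_id_subproof (X : normedModType K) : idfun \in bounded_linear X X.
Proof.
by apply/bounded_linearP; split=> //; exists 1 => x; rewrite mul1r.
Qed.

Definition blop_id (X : normedModType K) : blop X X := Blop (blop_id_subproof X).

Lemma blop_comp_subproof (X Y Z : normedModType K) (g : blop Y Z)
  (f : blop X Y) : g \o f \in bounded_linear X Z.
Proof.
have [M M0 fM] := blop_bounded f; have [N N0 gN] := blop_bounded g.
apply/bounded_linearP; split=> [a x y|] /=; first by rewrite !linearP.
by exists (N * M) => x; rewrite -mulrA (le_trans (gN _))// ler_wpM2l.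
Qed.

Definition blop_comp (X Y Z : normedModType K) (g : blop Y Z) (f : blop X Y) :
  blop X Z := Blop (blop_comp_subproof g f).

End composition.

Arguments blop_id {K} X.
Notation "g '\oB' f" := (blop_comp g f)
  (at level 40, left associativity) : ring_scope.

Section operator_norm.
Variables (R : realType) (k : scalar_kind).
Local Notation K := (scalar_field R k).
Local Notation re := (@scalar_re R k).
Local Notation of_re := (@scalar_of R k).
Variables (X Y : normedModType K).
Implicit Types (f g : blop X Y).

Definition opnorm f : R := sup [set re `|f x| | x in [set x | `|x| <= 1]].

Lemma opnorm_has_sup f : has_sup [set re `|f x| | x in [set x | `|x| <= 1]].
Proof.
have [M M0 fM] := blop_bounded f.
split; first by exists (re `|f 0|), 0 => //=; rewrite normr0.
exists (re M) => _ [x /= x1 <-]; rewrite ler_scalar_re//.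
by rewrite (le_trans (fM _))// ler_piMr.
Qed.

Lemma opnorm_ge f x : `|f x| <= of_re (opnorm f) * `|x|.
Proof.
have [->|x0] := eqVneq x 0; first by rewrite linear0 !normr0 mulr0.
rewrite -ler_pdivrMr ?normr_gt0//.
rewrite -[leLHS]scalar_reK ?mulr_ge0 ?invr_ge0// ler_scalar_of.
apply: ub_le_sup; first by have [] := opnorm_has_sup f.
exists (`|x|^-1 *: x) => /=; last by rewrite linearZ/= normrZ normfV normr_id mulrC.
by rewrite normrZ normfV normr_id mulVf// normr_eq0.
Qed.

Lemma opnorm_le f (M : K) : 0 <= M -> (forall x, `|f x| <= M * `|x|) ->
  of_re (opnorm f) <= M.
Proof.
move=> M0 fM; rewrite -[leRHS]scalar_reK// ler_scalar_of.
apply: ge_sup; first by have [] := opnorm_has_sup f.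
move=> _ [x /= x1 <-]; rewrite ler_scalar_re//.
by rewrite (le_trans (fM _))// ler_piMr.
Qed.

Lemma opnorm_ge0 f : 0 <= opnorm f.
Proof.
apply: le_trans (_ : re `|f 0| <= _); first exact: scalar_re_ge0.
apply: ub_le_sup; first by have [] := opnorm_has_sup f.
by exists 0 => //=; rewrite normr0.
Qed.

Let of_opnorm_ge0 f : 0 <= of_re (opnorm f).
Proof. by rewrite -(scalar_of0 R k) ler_scalar_of opnorm_ge0. Qed.

Let opnormD f g :
  of_re (opnorm (f + g)) <= of_re (opnorm f) + of_re (opnorm g).
Proof.
apply: opnorm_le => [|x]; first by rewrite addr_ge0.
by rewrite mulrDl (le_trans (ler_normD _ _))// lerD// opnorm_ge.
Qed.

Let opnormZ (a : K) f : of_re (opnorm (a *: f)) = `|a| * of_re (opnorm f).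
Proof.
have le b g : of_re (opnorm (b *: g)) <= `|b| * of_re (opnorm g).
  apply: opnorm_le => [|x]; first by rewrite mulr_ge0.
  by rewrite blopZ normrZ -mulrA ler_wpM2l// opnorm_ge.
apply/eqP; rewrite eq_le le/=.
have [->|a0] := eqVneq a 0; first by rewrite normr0 mul0r.
rewrite mulrC -ler_pdivlMr ?normr_gt0// mulrC -normfV.
by rewrite -[f in leLHS]scale1r -(mulVf a0) -scalerA.
Qed.

Let opnorm_eq0 f : of_re (opnorm f) = 0 -> f = 0.
Proof.
move=> f0; apply: blopP => x; apply/eqP.
by rewrite -normr_le0 (le_trans (opnorm_ge f x))// f0 mul0r.
Qed.

HB.instance Definition _ :=
  Lmodule_isNormed.Build K (blop X Y) opnormD opnormZ opnorm_eq0.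

Lemma blop_normE f : `|f| = of_re (opnorm f). Proof. by []. Qed.

Lemma ler_blop f x : `|f x| <= `|f| * `|x|. Proof. exact: opnorm_ge. Qed.

Lemma blop_norm_le f (M : K) : 0 <= M -> (forall x, `|f x| <= M * `|x|) ->
  `|f| <= M.
Proof. exact: opnorm_le. Qed.

End operator_norm.

Section compact_operators.
Variables (K : numFieldType) (X Y : normedModType K).

Definition compact_op (f : blop X Y) : Prop :=
  precompact (f @` [set x | `|x| <= 1]).

Lemma compact_opP (f : blop X Y) : compact_op f <->
  exists2 A : set Y, compact A & forall x, `|x| <= 1 -> A (f x).
Proof.
split=> [[A fA [cA _]]|[A cA fA]].
  by exists A => // x x1; apply: fA; exists x.
have := compact_precompact (@norm_hausdorff _ Y) cA.
by apply: precompact_subset => _ [x x1 <-]; exact: fA.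
Qed.

Definition compact_ops : {pred blop X Y} := [pred f | `[< compact_op f >]].

Lemma compact_opsP (f : blop X Y) : reflect (compact_op f) (f \in compact_ops).
Proof. exact: asboolP. Qed.

Lemma compact_ops_submod_closed : submod_closed compact_ops.
Proof.
split=> [|a f g].
  apply/compact_opsP/compact_opP; exists [set 0]; first exact: compact_set1.
  by move=> x _.
move=> /compact_opsP/compact_opP[A cA fA] /compact_opsP/compact_opP[B cB gB].
apply/compact_opsP/compact_opP.
exists ((fun p : Y * Y => a *: p.1 + p.2) @` (A `*` B)); last first.
  by move=> x x1; exists (f x, g x) => //=; split; [exact: fA|exact: gB].
apply: continuous_compact; last exact: compact_setX.
apply: continuous_subspaceT => p.
apply: cvgD; last exact: cvg_snd.
by apply: cvgZr; exact: cvg_fst.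
Qed.

HB.instance Definition _ :=
  GRing.isSubmodClosed.Build K (blop X Y) compact_ops
    compact_ops_submod_closed.

End compact_operators.

Arguments compact_ops {K} X Y.

Section compact_comp.
Variable K : numFieldType.

Lemma blop_continuous (X Y : normedModType K) (f : blop X Y) : continuous f.
Proof.
apply: bounded_linear_continuous.
have [M M0 fM] := blop_bounded f.
apply/linear_boundedP; near=> r => x.
rewrite (le_trans (fM x))// ler_wpM2r//.
by near: r; apply: nbhs_pinfty_ge; rewrite ger0_real.
Unshelve. all: by end_near. Qed.

Lemma compact_op_compl (X Y Z : normedModType K) (g : blop Y Z) (f : blop X Y) :
  compact_op f -> compact_op (g \oB f).
Proof.
move=> /compact_opP[A cA fA]; apply/compact_opP; exists (g @` A).
  by apply: continuous_compact => //; exact/continuous_subspaceT/blop_continuous.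
by move=> x x1; exists (f x) => //; exact: fA.
Qed.

Lemma compact_op_compr (X Y Z : normedModType K) (g : blop Y Z) (f : blop X Y) :
  compact_op g -> compact_op (g \oB f).
Proof.
move=> /compact_opP[A cA gA]; apply/compact_opP.
have [M M0 fM] := blop_bounded f.
have M1 : 0 < M + 1 by rewrite ltr_wpDl.
exists ((fun y => (M + 1) *: y) @` A).
  by apply: continuous_compact => //; exact/continuous_subspaceT/scaler_continuous.
move=> x x1; exists (g ((M + 1)^-1 *: f x)).
  apply: gA; rewrite normrZ gtr0_norm ?invr_gt0// mulrC ler_pdivrMr// mul1r.
  rewrite (le_trans (fM x))// (@le_trans _ _ M)// ?ler_piMr//.
  by rewrite lerDl.
by rewrite /= linearZ/= scalerA mulfV ?scale1r// gt_eqF.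
Qed.

Lemma normed_ballP (Y : normedModType K) (z y : Y) (e : K) :
  ball z e y <-> `|z - y| < e.
Proof. by rewrite -ball_normE. Qed.

Lemma compact_ball_cover (Y : normedModType K) (A : set Y) (e : K) :
  compact A -> 0 < e -> exists s : seq Y,
    forall y, A y -> exists2 z, z \in s & `|z - y| < e.
Proof.
rewrite compact_cover => cA e0.
have [||D _ AD] := cA Y setT (fun z => ball z e).
- by move=> z _; exact: ball_open.
- by move=> y _; exists y => //; exact: ballxx.
exists (finmap.enum_fset D) => y /AD[z /= zD]; rewrite -ball_normE /= => yz.
by exists z.
Qed.

Lemma ultra_finite (T : Type) (I : eqType) (F : set_system T) (s : seq I)
    (B : I -> set T) : UltraFilter F ->
  F [set t | exists2 i, i \in s & B i t] -> exists i, F (B i).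
Proof.
move=> FU; elim: s => [|i s ih] FB.
  have : F set0 by apply: filterS FB => t [].
  by move/filter_not_empty.
have [Fi|Fi] := in_ultra_setVsetC (B i) FU; first by exists i.
apply: ih; apply: filterS2 Fi FB => t /= nBi [j].
by rewrite inE => /orP[/eqP->//|js Bj]; exists j.
Qed.

Lemma closed_compact_op (X : normedModType K) (Y : completeNormedModType K)
    (f : blop X Y) :
  (forall e : K, 0 < e -> exists2 g : blop X Y, compact_op g &
    forall x, `|f x - g x| <= e * `|x|) -> compact_op f.
Proof.
move=> fg; rewrite /compact_op precompactE compact_ultra => F FU Fcl.
suff /cauchy_cvg : cauchy F.
  move=> /cvg_ex[l Fl]; exists l; split=> //.
  apply: closed_closure => B /Fl FB.
  exact: filter_ex (filterI Fcl FB).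
apply: cauchy_exP => e e0.
have e40 : 0 < e / 2 / 2 by rewrite !divr_gt0.
have [g /compact_opP[A cA gA] fge] := fg _ e40.
have [s sA] := compact_ball_cover cA e40.
have : F [set y | exists2 z, z \in s & ball z e y].
  apply: filterS Fcl => y fy.
  have [_ [[x /= x1 <-]]] := fy _ (nbhsx_ballx y (e / 2 / 2) e40).
  move=> /normed_ballP yfx.
  have [z zs zgx] := sA _ (gA _ x1); exists z => //.
  apply/normed_ballP.
  rewrite (le_lt_trans (ler_distD (g x) z y))//.
  have e44 : e = e / 2 / 2 + (e / 2 / 2 + (e / 2 / 2 + e / 2 / 2)).
    by rewrite addrA -splitr -splitr.
  rewrite [ltRHS]e44 ltr_leD//.
  rewrite (le_trans (ler_distD (f x) (g x) y))// lerD//.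
    by rewrite distrC (le_trans (fge x))// ler_piMr// ltW.
  by rewrite distrC (le_trans (ltW yfx))// lerDl ltW.
by move=> /(ultra_finite FU)[z]; exists z.
Qed.

End compact_comp.

Section calkin.
Variables (R : realType) (k : scalar_kind).
Local Notation K := (scalar_field R k).
Local Notation re := (@scalar_re R k).
Local Notation of_re := (@scalar_of R k).
Local Open Scope quotient_scope.

Section calkin_lmodule.
Variables (X Y : completeNormedModType K).

Definition calkin : Type := Quotient.quot (compact_ops X Y).

HB.instance Definition _ := GRing.Zmodule.on calkin.
HB.instance Definition _ := Quotient.on calkin.

Definition calkin_pi (f : blop X Y) : calkin := \pi_calkin f.

Lemma calkin_piP (c : calkin) : exists f, c = calkin_pi f.
Proof. by exists (repr c); rewrite /calkin_pi reprK. Qed.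

Lemma calkin_pi_eq (f g : blop X Y) :
  calkin_pi f = calkin_pi g <-> compact_op (f - g).
Proof.
split=> [/eqP fg|fg].
  by apply/compact_opsP; move: fg; rewrite -Quotient.idealrBE.
by apply/eqP; rewrite -Quotient.idealrBE; apply/compact_opsP.
Qed.

Lemma calkin_piD (f g : blop X Y) :
  calkin_pi (f + g) = calkin_pi f + calkin_pi g.
Proof. exact: Quotient.pi_add. Qed.

Definition calkin_scale (a : K) (c : calkin) : calkin :=
  calkin_pi (a *: repr c).

Lemma calkin_piZ a (f : blop X Y) :
  calkin_scale a (calkin_pi f) = calkin_pi (a *: f).
Proof.
apply/calkin_pi_eq; rewrite -scalerBr.
apply/compact_opsP/rpredZ/compact_opsP/calkin_pi_eq.
by rewrite /calkin_pi reprK.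
Qed.

Let calkin_scalerA a b c :
  calkin_scale a (calkin_scale b c) = calkin_scale (a * b) c.
Proof. by have [f ->] := calkin_piP c; rewrite !calkin_piZ scalerA. Qed.

Let calkin_scale1r : left_id 1 calkin_scale.
Proof. by move=> c; have [f ->] := calkin_piP c; rewrite calkin_piZ scale1r. Qed.

Let calkin_scalerDr : right_distributive calkin_scale +%R.
Proof.
move=> a c d; have [f ->] := calkin_piP c; have [g ->] := calkin_piP d.
by rewrite -calkin_piD !calkin_piZ scalerDr calkin_piD.
Qed.

Let calkin_scalerDl c : {morph calkin_scale^~ c : a b / a + b}.
Proof.
move=> a b; have [f ->] := calkin_piP c.
by rewrite !calkin_piZ scalerDl calkin_piD.
Qed.

HB.instance Definition _ := GRing.Zmodule_isLmodule.Build K calkin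
  calkin_scalerA calkin_scale1r calkin_scalerDr calkin_scalerDl.

Lemma calkin_pi_linear : linear calkin_pi.
Proof. by move=> a f g; rewrite calkin_piD -calkin_piZ. Qed.

HB.instance Definition _ :=
  GRing.isLinear.Build K (blop X Y) calkin *:%R calkin_pi calkin_pi_linear.

Definition calkin_norm (c : calkin) : R :=
  inf [set re `|f| | f in [set f | calkin_pi f = c]].

Lemma calkin_has_inf (c : calkin) :
  has_inf [set re `|f| | f in [set f | calkin_pi f = c]].
Proof.
split; first by have [f ->] := calkin_piP c; exists (re `|f|), f.
by exists 0 => _ [f _ <-]; exact: scalar_re_ge0.
Qed.

Lemma calkin_norm_le (f : blop X Y) : of_re (calkin_norm (calkin_pi f)) <= `|f|.
Proof.
rewrite -[leRHS]scalar_reK// ler_scalar_of.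
by apply: ge_inf; [have [] := calkin_has_inf (calkin_pi f)|exists f].
Qed.

Lemma calkin_norm_lt (c : calkin) (e : K) : 0 < e ->
  exists2 f, calkin_pi f = c & `|f| < of_re (calkin_norm c) + e.
Proof.
move=> e0.
have [_ [f fc <-]] := inf_adherent (scalar_re_gt0 e0) (calkin_has_inf c).
rewrite -(ltr_scalar_of k) scalar_ofD !scalar_reK// ?ltW// => fe.
by exists f.
Qed.

Lemma calkin_norm_ge0 (c : calkin) : 0 <= of_re (calkin_norm c).
Proof.
rewrite -(scalar_of0 R k) ler_scalar_of.
apply: lb_le_inf; first by have [] := calkin_has_inf c.
by move=> _ [f _ <-]; exact: scalar_re_ge0.
Qed.

Let calkin_normD (c d : calkin) :
  of_re (calkin_norm (c + d)) <= of_re (calkin_norm c) + of_re (calkin_norm d).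
Proof.
apply/ler_addgt0Pr => e e0.
have [f <- fe] := calkin_norm_lt c (divr_gt0 e0 (ltr0n _ 2)).
have [g <- ge] := calkin_norm_lt d (divr_gt0 e0 (ltr0n _ 2)).
rewrite -calkin_piD (le_trans (calkin_norm_le _))//.
rewrite (le_trans (ler_normD _ _))// [e in leRHS]splitr addrACA.
by rewrite lerD// ltW.
Qed.

Let calkin_normZ (a : K) (c : calkin) :
  of_re (calkin_norm (a *: c)) = `|a| * of_re (calkin_norm c).
Proof.
have le b d : of_re (calkin_norm (b *: d)) <= `|b| * of_re (calkin_norm d).
  apply/ler_addgt0Pr => e e0.
  have b1 : 0 < `|b| + 1 by rewrite ltr_wpDl.
  have [f <- fe] := calkin_norm_lt d (divr_gt0 e0 b1).
  rewrite -linearZ (le_trans (calkin_norm_le _))// normrZ.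
  rewrite (le_trans (ler_wpM2l _ (ltW fe)))// mulrDr lerD2l.
  by rewrite mulrCA ger_pMr// ler_pdivrMr// mul1r lerDl.
apply/eqP; rewrite eq_le le/=.
have [->|a0] := eqVneq a 0; first by rewrite normr0 mul0r calkin_norm_ge0.
rewrite mulrC -ler_pdivlMr ?normr_gt0// mulrC -normfV.
by rewrite -[c in leLHS]scale1r -(mulVf a0) -scalerA.
Qed.

Let calkin_norm_eq0 (c : calkin) : of_re (calkin_norm c) = 0 -> c = 0.
Proof.
move=> c0; have [f fc] := calkin_piP c; rewrite fc.
have -> : 0 = calkin_pi 0 by rewrite linear0.
apply/calkin_pi_eq; rewrite subr0; apply: closed_compact_op => e e0.
have [g gc ge] := calkin_norm_lt c e0.
exists (f - g); first by apply/calkin_pi_eq; rewrite gc.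
move=> x; rewrite blopB opprB addrC subrK.
rewrite (le_trans (ler_blop _ _))// ler_wpM2r// ltW//.
by move: ge; rewrite c0 add0r.
Qed.

HB.instance Definition _ := Lmodule_isNormed.Build K calkin
  calkin_normD calkin_normZ calkin_norm_eq0.

End calkin_lmodule.

Section multiplication_operators.
Variables (E F Z : completeNormedModType K).

(* Defined through a chosen representative; lmul_pi and rmul_pi give the
   values on an arbitrary one. *)
Definition lmul_fun (A : blop E F) (c : calkin Z E) : calkin Z F :=
  calkin_pi (A \oB repr c).

Lemma lmul_fun_pi (A : blop E F) (V : blop Z E) :
  lmul_fun A (calkin_pi V) = calkin_pi (A \oB V).
Proof.
apply/calkin_pi_eq.
have -> : A \oB repr (calkin_pi V) - A \oB V = A \oB (repr (calkin_pi V) - V).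
  by apply: blopP => x; exact/esym/(linearB A).
apply: compact_op_compl; apply/calkin_pi_eq.
by rewrite /calkin_pi reprK.
Qed.

Lemma lmul_subproof (A : blop E F) :
  lmul_fun A \in bounded_linear (calkin Z E) (calkin Z F).
Proof.
apply/bounded_linearP; split.
  move=> a c d; have [f ->] := calkin_piP c; have [g ->] := calkin_piP d.
  rewrite -linearP !lmul_fun_pi -linearP; congr calkin_pi.
  by apply: blopP => x; exact: (linearP A).
exists `|A| => c; apply/ler_addgt0Pr => e e0.
have A1 : 0 < `|A| + 1 by rewrite ltr_wpDl.
have [f <- fe] := calkin_norm_lt c (divr_gt0 e0 A1).
rewrite lmul_fun_pi (le_trans (calkin_norm_le _))//.
apply: (@le_trans _ _ (`|A| * `|f|)).
  apply: blop_norm_le => [|x]; first by rewrite mulr_ge0.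
  by rewrite (le_trans (ler_blop A (f x)))// -mulrA ler_wpM2l// ler_blop.
rewrite (le_trans (ler_wpM2l _ (ltW fe)))// mulrDr lerD2l.
by rewrite mulrCA ger_pMr// ler_pdivrMr// mul1r lerDl.
Qed.

Definition lmul (A : blop E F) : blop (calkin Z E) (calkin Z F) :=
  Blop (lmul_subproof A).

Lemma lmul_pi (A : blop E F) (V : blop Z E) :
  lmul A (calkin_pi V) = calkin_pi (A \oB V).
Proof. exact: lmul_fun_pi. Qed.

Definition rmul_fun (A : blop E F) (c : calkin F Z) : calkin E Z :=
  calkin_pi (repr c \oB A).

Lemma rmul_fun_pi (A : blop E F) (W : blop F Z) :
  rmul_fun A (calkin_pi W) = calkin_pi (W \oB A).
Proof.
apply/calkin_pi_eq.
have -> : repr (calkin_pi W) \oB A - W \oB A = (repr (calkin_pi W) - W) \oB A.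
  by apply: blopP => x.
apply: compact_op_compr; apply/calkin_pi_eq.
by rewrite /calkin_pi reprK.
Qed.

Lemma rmul_subproof (A : blop E F) :
  rmul_fun A \in bounded_linear (calkin F Z) (calkin E Z).
Proof.
apply/bounded_linearP; split.
  move=> a c d; have [f ->] := calkin_piP c; have [g ->] := calkin_piP d.
  rewrite -linearP !rmul_fun_pi -linearP; congr calkin_pi.
  by apply: blopP => x.
exists `|A| => c; apply/ler_addgt0Pr => e e0.
have A1 : 0 < `|A| + 1 by rewrite ltr_wpDl.
have [f <- fe] := calkin_norm_lt c (divr_gt0 e0 A1).
rewrite rmul_fun_pi (le_trans (calkin_norm_le _))//.
apply: (@le_trans _ _ (`|A| * `|f|)).
  apply: blop_norm_le => [|x]; first by rewrite mulr_ge0.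
  rewrite (le_trans (ler_blop f (A x)))// [`|A| * _]mulrC -mulrA.
  by rewrite ler_wpM2l// ler_blop.
rewrite (le_trans (ler_wpM2l _ (ltW fe)))// mulrDr lerD2l.
by rewrite mulrCA ger_pMr// ler_pdivrMr// mul1r lerDl.
Qed.

Definition rmul (A : blop E F) : blop (calkin F Z) (calkin E Z) :=
  Blop (rmul_subproof A).

Lemma rmul_pi (A : blop E F) (W : blop F Z) :
  rmul A (calkin_pi W) = calkin_pi (W \oB A).
Proof. exact: rmul_fun_pi. Qed.

End multiplication_operators.

End calkin.

Arguments lmul {R k E F} Z A.
Arguments rmul {R k E F} Z A.

Section fredholm_pairs.
Variable K : numFieldType.

(* For linear subspaces B `<=` A of X, the quotient A / B is spanned by the
   cosets of finitely many elements of A. *)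
Definition findim_quotient (X : lmodType K) (A B : set X) : Prop :=
  exists (n : nat) (v : 'I_n -> X), (forall i, A (v i)) /\
    forall x, A x -> exists c : 'I_n -> K, B (x - \sum_i c i *: v i).

Definition findim (X : lmodType K) (A : set X) : Prop :=
  findim_quotient A [set 0].

Definition null_space (X Y : normedModType K) (A : blop X Y) : set X :=
  [set x | A x = 0].

Definition generalized_inverse (X Y : normedModType K)
    (T : blop Y X) (T' : blop X Y) : Prop :=
  T = T \oB T' \oB T.

Definition regular (X Y : normedModType K) (T : blop Y X) : Prop :=
  exists T' : blop X Y, generalized_inverse T T'.

Definition fredholm_pair (X Y : normedModType K)
    (S : blop X Y) (T : blop Y X) : Prop :=
  [/\ findim_quotient (null_space S) (null_space S `&` range T),
      findim_quotient (range T) (null_space S `&` range T),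
      findim_quotient (null_space T) (null_space T `&` range S) &
      findim_quotient (range S) (null_space T `&` range S)].

Definition regular_fredholm_pair (X Y : normedModType K)
    (S : blop X Y) (T : blop Y X) : Prop :=
  [/\ fredholm_pair S T, regular S & regular T].

Definition invertible (X : normedModType K) (U : blop X X) : Prop :=
  exists V : blop X X, U \oB V = blop_id X /\ V \oB U = blop_id X.

End fredholm_pairs.

(* Main.v *)
Require Import Defs.
From mathcomp Require Import all_boot all_order all_algebra.
From mathcomp Require Import complex.
From mathcomp Require finmap.
From mathcomp Require Import all_classical all_reals all_analysis.

Set Implicit Arguments.
Unset Strict Implicit.
Unset Printing Implicit Defensive.

Import Order.TTheory GRing.Theory Num.Theory.
Import numFieldNormedType.Exports.

Local Open Scope classical_set_scope.
Local Open Scope ring_scope.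

(** The regularity of [S] and [T] turns the pair into two projections on each
    space.  On [X], [P = S'S] is a projection with kernel [N(S)], and [Q = TT']
    is a projection with range [R(T)]; [PQ = S'(ST)T'] has finite rank.  The
    operators of the theorem are the multiplications by [P + Q], and by the
    analogous sum on [Y], which is obtained by exchanging [S] and [T].
    Everything rests on the defect [W = (1 - Q)(1 - P)].

    - The pair is Fredholm, as far as [N(S)] and [R(T)] are concerned, iff [W]
      has finite rank ([half_fredholmP]): [1 - Q] maps [N(S)], the range of
      [1 - P], onto the range of [W], and its kernel there is the intersection
      of [N(S)] and [R(T)]; the quotient of [R(T)] by this intersection is
      isomorphic to the range of [ST], which is finite dimensional anyway.

    - Modulo compact operators, write [p], [q], [w] for the classes of [P], [Q],
      [W].  As [pq = 0], [p + q = 1 + qp - w] and [qp] has square zero.  If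
      [w = 0], then [1 - qp] is an inverse of [p + q], hence so are the
      multiplications by it ([defect_calkin_inverse]).  Conversely
      [(p + q)w = 0 = w(p + q)], so that injectivity of left or right
      multiplication by [p + q] on the quotient of [L(X)] forces [w = 0]
      ([lmul_compact_cancel], [rmul_compact_cancel]).

    - If [W] is compact, it has finite rank ([compact_defect_finite_rank]).
      Indeed [W^2 - W = (1 - Q)PQ(1 - P)] has finite rank, so, on a subspace
      of finite codimension, [W] takes its values in its own fixed space, and
      the fixed space of a compact operator is finite dimensional
      ([compact_fixed_space]).

    The remaining work is the elementary theory of finite-dimensional subspaces
    of a normed space: they are closed, with bounded coordinates
    ([bounded_coef_ex], [lspan_closed]), whence finite-rank operators are
    compact ([finite_rank_compact]). *)

(** * Finitely generated subspaces *)

Section linear_span.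
Variables (K : fieldType) (V : lmodType K).
Implicit Types (s t : seq V) (x y z : V) (a : K).

(** The recursion peels off one generator at a time: this is the form in which
    all the inductions on generating lists below proceed.  [lspan_sum] and
    [lspan_coef] relate it to linear combinations indexed by ordinals. *)
Fixpoint lspan s : set V :=
  if s is z :: s' then [set x | exists a, lspan s' (x - a *: z)] else [set 0].

Lemma lspan0 s : lspan s 0.
Proof.
by elim: s => [//|z s ih]; exists 0; rewrite scale0r subr0.
Qed.

Lemma lspanD s x y : lspan s x -> lspan s y -> lspan s (x + y).
Proof.
elim: s x y => [|z s ih] x y; first by move=> -> ->; rewrite /= addr0.
move=> [a xa] [b yb]; exists (a + b).
by rewrite scalerDl opprD addrACA; exact: ih.
Qed.

Lemma lspanZ s a x : lspan s x -> lspan s (a *: x).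
Proof.
elim: s x => [|z s ih] x; first by move=> ->; rewrite /= scaler0.
by move=> [b xb]; exists (a * b); rewrite -scalerA -scalerBr; exact: ih.
Qed.

Lemma lspanB s x y : lspan s x -> lspan s y -> lspan s (x - y).
Proof.
by move=> sx sy; apply: lspanD => //; rewrite -scaleN1r; exact: lspanZ.
Qed.

Lemma lspan_cons z s x : lspan s x -> lspan (z :: s) x.
Proof. by move=> sx; exists 0; rewrite scale0r subr0. Qed.

Lemma lspan_mem s z : z \in s -> lspan s z.
Proof.
elim: s => [//|y s ih]; rewrite inE => /orP[/eqP <-|/ih/lspan_cons//].
by exists 1; rewrite scale1r subrr; exact: lspan0.
Qed.

Lemma lspan_sum s n (c : 'I_n -> K) (v : 'I_n -> V) :
  (forall i, v i \in s) -> lspan s (\sum_i c i *: v i).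
Proof.
move=> vs; elim/big_ind: _ => [|x y|i _]; first exact: lspan0.
  exact: lspanD.
exact/lspanZ/lspan_mem.
Qed.

Lemma lspan_coef s x : lspan s x ->
  exists c : 'I_(size s) -> K, x = \sum_i c i *: s`_i.
Proof.
elim: s x => [|z s ih] x.
  by move=> ->; exists (fun=> 0); rewrite big_ord0.
move=> [a /ih[c xc]]; exists (fun i => oapp c a (unlift ord0 i)).
rewrite big_ord_recl unlift_none /=.
under eq_bigr do rewrite liftK.
by rewrite -xc addrC subrK.
Qed.

Lemma lspan_sub s (A : set V) :
  A 0 -> (forall a x y, A x -> A y -> A (a *: x + y)) ->
  (forall z, z \in s -> A z) -> lspan s `<=` A.
Proof.
move=> A0 AD sA x /lspan_coef[c ->].
elim/big_ind: _ => [//|y z Ay Az|i _]; first by rewrite -[y]scale1r; exact: AD.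
by rewrite -[_ *: _]addr0; apply: AD => //; apply/sA/mem_nth.
Qed.

Lemma lspan_subset s t : {subset s <= t} -> lspan s `<=` lspan t.
Proof.
move=> st; apply: lspan_sub => [|a x y tx ty|z /st]; first exact: lspan0.
  by apply: lspanD => //; exact: lspanZ.
exact: lspan_mem.
Qed.

End linear_span.

Lemma lspan_map (K : fieldType) (U V : lmodType K) (f : {linear U -> V})
  (s : seq U) x : lspan s x -> lspan (map f s) (f x).
Proof.
elim: s x => [|z s ih] x; first by move=> ->; rewrite /= linear0.
by move=> [a /ih]; rewrite linearB linearZ /= => xa; exists a.
Qed.

(** Gaussian elimination: either the first generator [z] is superfluous, or some
    [f x0] with [x0] in [A] has a nonzero coordinate [c0] along [z], and
    subtracting multiples of [x0] reduces to the subspace [B] of [A] which [f]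
    maps into the span of the other generators.  Quotients are finite
    dimensional through representatives taken in the subspace itself, hence
    the generators [t] in [A]. *)
Lemma lspan_preimage (K : fieldType) (U V : lmodType K) (f : {linear U -> V})
    (s : seq V) (A : set U) :
  A 0 -> (forall a x y, A x -> A y -> A (a *: x + y)) ->
  (forall x, A x -> lspan s (f x)) ->
  exists t : seq U, (forall u, u \in t -> A u) /\
    forall x, A x -> exists2 y, lspan t y & f x = f y.
Proof.
elim: s A => [|z s ih] A A0 AD fA.
  exists [::]; split=> // x /fA ->; exists 0 => //; by rewrite linear0.
pose B := [set x | A x /\ lspan s (f x)].
have [t [tB Bt]] : exists t : seq U, (forall u, u \in t -> B u) /\
    forall x, B x -> exists2 y, lspan t y & f x = f y.
  apply: ih => [|a x y [Ax sx] [Ay sy]|x []//].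
    by split=> //; rewrite linear0; exact: lspan0.
  by split; [exact: AD|rewrite linearP; apply: lspanD => //; exact: lspanZ].
have [AB|] := pselect (forall x, A x -> lspan s (f x)).
  exists t; split=> [u /tB[]//|x Ax]; apply: Bt; split=> //; exact: AB.
move=> /existsNP[x0 /not_implyP[Ax0 nx0]].
have [c0 sc0] := fA _ Ax0.
have c00 : c0 != 0.
  by apply/eqP => c00; apply: nx0; move: sc0; rewrite c00 scale0r subr0.
exists (x0 :: t); split=> [u|x Ax].
  by rewrite inE => /orP[/eqP->//|/tB[]].
have [c sc] := fA _ Ax.
have [|y ty fy] := Bt (- (c / c0) *: x0 + x).
  split; first exact: AD.
  suff -> : f (- (c / c0) *: x0 + x) =
      (f x - c *: z) - (c / c0) *: (f x0 - c0 *: z).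
    by apply: lspanB => //; exact: lspanZ.
  rewrite linearP scalerBr scalerA divfK// opprB addrA subrK scaleNr.
  by rewrite addrC.
exists (y + (c / c0) *: x0); first by exists (c / c0); rewrite addrK.
by rewrite linearD -fy linearP linearZ scaleNr /= addrAC addNr add0r.
Qed.

Section finite_dimensional_quotients.
Variables (K : numFieldType) (V : lmodType K).
Implicit Types A B : set V.

Lemma findim_quotientP A B : findim_quotient A B <->
  exists s : seq V, (forall z, z \in s -> A z) /\
    forall x, A x -> exists2 y, lspan s y & B (x - y).
Proof.
split=> [[n [v [vA AB]]]|[s [sA AB]]].
  exists [seq v i | i : 'I_n]; split=> [z /mapP[i _ ->]|x /AB[c xc]].
    exact: vA.
  exists (\sum_i c i *: v i) => //.
  by apply: lspan_sum => i; apply: map_f; rewrite mem_enum.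
exists (size s), (fun i => s`_i); split=> [i|x /AB[y sy xy]].
  exact/sA/mem_nth.
by have [c yc] := lspan_coef sy; exists c; rewrite -yc.
Qed.

End finite_dimensional_quotients.

(** * Compactness in the field of scalars *)

Lemma scalar_of_continuous (R : realType) (k : scalar_kind) :
  continuous (@scalar_of R k : R -> scalar_field R k).
Proof.
case: k => x; first exact: cvg_id.
apply/cvgrPdist_lt => e e0.
have re0 := @scalar_re_gt0 R ComplexScalars _ e0.
near=> y.
rewrite -[e](@scalar_reK R ComplexScalars) ?ltW//=.
rewrite -rmorphB normc_def/= expr0n addr0 sqrtr_sqr ltcR.
near: y; exact: (cvgr_dist_lt id x).
Unshelve. all: by end_near. Qed.

(** Local compactness of the scalars, real or complex.  The compact set may be
    larger than the ball: in the complex case it is a square, the image of a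
    product of two real segments. *)
Lemma scalar_bounded_subset_compact (R : realType) (k : scalar_kind)
    (r : scalar_field R k) :
  exists2 C : set (scalar_field R k), compact C & forall a, `|a| <= r -> C a.
Proof.
case: k r => /= r.
  exists `[- r, r]%classic; first exact: segment_compact.
  by move=> a; rewrite /= in_itv/= ler_norml.
pose I : set R := `[- complex.Re r, complex.Re r]%classic.
pose f (p : R * R) : scalar_field R ComplexScalars :=
  @scalar_of R ComplexScalars p.1 + 'i%C * @scalar_of R ComplexScalars p.2.
exists (f @` (I `*` I)).
  apply: continuous_compact.
    apply: continuous_subspaceT => p.
    apply: cvgD.
      apply: (cvg_comp fst (@scalar_of R ComplexScalars)); first exact: cvg_fst.
      exact: (@scalar_of_continuous R ComplexScalars p.1).
    apply: cvgM; first exact: cvg_cst.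
    apply: (cvg_comp snd (@scalar_of R ComplexScalars)); first exact: cvg_snd.
    exact: (@scalar_of_continuous R ComplexScalars p.2).
  by apply: compact_setX; exact: segment_compact.
have Rele (b : R[i]) : `|b| <= r -> I (complex.Re b).
  move=> br; rewrite /I /= in_itv/= -ler_norml.
  have : `|complex.Re b|%:C%C <= r := le_trans (normc_ge_Re b) br.
  by rewrite lecE => /andP[].
move=> a ar; exists (complex.Re a, complex.Im a); last first.
  by rewrite /f/= [RHS]complexE.
split => /=; first exact: Rele.
suff -> : complex.Im a = complex.Re (- 'i%C * a).
  apply: Rele; rewrite normrM normrN normc_def/= expr0n/= add0r expr1n.
  by rewrite sqrtr1 mul1r.
by case: a {ar} => u v /=; rewrite oppr0 mul0r mulN1r opprK add0r.
Qed.

Lemma scalar_half_pow_lt (R : realType) (k : scalar_kind)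
    (e : scalar_field R k) : 0 < e -> exists n, 2^-1 ^+ n < e.
Proof.
move=> e0; have re0 := scalar_re_gt0 e0.
have [n _ /(_ n (leqnn n))] := near_infty_natSinv_expn_lt (PosNum re0).
rewrite /= -(ltr_scalar_of k) scalar_reK ?ltW// => ne; exists n.
suff <- : @scalar_of R k (1 / 2 ^+ n) = 2^-1 ^+ n by [].
rewrite div1r -exprVn; elim: n {ne} => [|n ih].
  by rewrite !expr0 scalar_of1.
rewrite !exprS scalar_ofM ih; congr (_ * _).
apply: (mulIf (_ : (2 : scalar_field R k) != 0)) => //.
have of2 : @scalar_of R k 2 = 2.
  by rewrite mulr2n scalar_ofD scalar_of1 -mulr2n.
by rewrite mulVf// -of2 -scalar_ofM mulVf// scalar_of1.
Qed.

(** * Finite-dimensional subspaces of a normed space *)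

Section spans_in_normed_spaces.
Variables (R : realType) (k : scalar_kind).
Local Notation K := (scalar_field R k).
Variable X : normedModType K.
Implicit Types (s : seq X) (x y z : X).

(** Dependent generators have no coordinate map, so that compactness is stated
    for the combinations whose coefficients are bounded by [r].  Keeping [C]
    inside the span is what makes the span closed in [bounded_coef_closed]. *)
Lemma lspan_box_compact s (r : K) : exists C : set X,
  [/\ compact C, C `<=` lspan s & forall c : 'I_(size s) -> K,
    (forall i, `|c i| <= r) -> C (\sum_i c i *: s`_i)].
Proof.
elim: s => [|z s [C [cC Cs sC]]].
  exists [set 0]; split; [exact: compact_set1|by []|move=> c _].
  by rewrite big_ord0.
have [B cB rB] := scalar_bounded_subset_compact r.
exists ((fun p : K * X => p.1 *: z + p.2) @` (B `*` C)); split.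
- apply: continuous_compact; last exact: compact_setX.
  apply: continuous_subspaceT => p.
  apply: cvgD; last exact: cvg_snd.
  by apply: cvgZr_tmp; exact: cvg_fst.
- move=> _ [[a w] [/= _ Cw] <-]; exists a; rewrite addrAC subrr add0r.
  exact: Cs.
- move=> c cr; exists (c ord0, \sum_i c (lift ord0 i) *: s`_i).
    by split=> /=; [exact: rB|apply: sC => i].
  by rewrite big_ord_recl.
Qed.

Definition bounded_coef s (M : K) := forall y, lspan s y ->
  exists2 c : 'I_(size s) -> K, y = \sum_i c i *: s`_i &
    forall i, `|c i| <= M * `|y|.

(** A point of the closure is a limit of elements of norm at most [|y| + 1].
    Their coordinates can be bounded, so they stay in a compact, hence closed,
    subset of the span. *)
Lemma bounded_coef_closed s (M : K) : 0 <= M -> bounded_coef s M ->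
  closed (lspan s).
Proof.
move=> M0 sM y sy.
have [C [cC Cs sC]] := lspan_box_compact s (M * (`|y| + 1)).
apply/Cs/(compact_closed (@norm_hausdorff _ X) cC) => B yB.
have [x [sx [Bx /normed_ballP xy]]] :=
  sy _ (filterI yB (nbhsx_ballx y 1 ltr01)).
exists x; split=> //; have [c xE cM] := sM _ sx; rewrite xE; apply: sC => i.
rewrite (le_trans (cM i))// ler_wpM2l// -lerBlDl.
by rewrite (le_trans (lerB_dist _ _))// distrC ltW.
Qed.

Lemma closed_dist_gt0 (A : set X) z : closed A -> ~ A z ->
  exists2 d : K, 0 < d & forall w, A w -> d <= `|z - w|.
Proof.
move=> cA nAz.
have : nbhs z (~` A) by apply: open_nbhs_nbhs; split=> //; exact: closed_openC.
move=> /nbhs_ballP[d /= d0 dA]; exists d => // w Aw.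
rewrite real_leNgt ?normr_real ?gtr0_real//; apply/negP => zw.
by apply: (dA w) => //; apply/normed_ballP.
Qed.

(** Adding to a subspace a vector [z] outside it keeps coordinates bounded: the
    subspace is closed by [bounded_coef_closed], so [z] is at a distance
    [d > 0] from it, and the coordinate [a] of [y] along [z] satisfies
    [|a| d <= |y|]; what is left of [y] has norm at most
    [(1 + |z| / d) |y|]. *)
Lemma bounded_coef_ex s : exists2 M : K, 0 <= M & bounded_coef s M.
Proof.
elim: s => [|z s [M M0 sM]].
  exists 0 => // y ->; exists (fun=> 0) => [|[]//]; by rewrite big_ord0.
have [zs|nzs] := pselect (lspan s z).
  exists M => // y [a ya].
  have sy : lspan s y.
    by rewrite -(subrK (a *: z) y); apply: lspanD => //; exact: lspanZ.
  have [c yc cM] := sM _ sy; exists (fun i => oapp c 0 (unlift ord0 i)).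
    rewrite big_ord_recl unlift_none /= scale0r add0r.
    by under eq_bigr do rewrite liftK.
  by move=> i; case: (unlift ord0 i) => //=; rewrite normr0 mulr_ge0.
have [d d0 dz] := closed_dist_gt0 (bounded_coef_closed M0 sM) nzs.
pose N := M * (1 + d^-1 * `|z|).
have dV0 : 0 <= d^-1 by rewrite invr_ge0 ltW.
have N0 : 0 <= N by rewrite mulr_ge0// addr_ge0// mulr_ge0.
exists (d^-1 + N) => [|y [a ya]]; first by rewrite addr_ge0.
have ale : `|a| <= d^-1 * `|y|.
  have [->|a0] := eqVneq a 0; first by rewrite normr0 mulr_ge0.
  rewrite mulrC ler_pdivlMr//.
  have /dz : lspan s (- a^-1 *: (y - a *: z)) by exact: lspanZ.
  rewrite scalerBr scalerA mulNr mulVf// !scaleNr scale1r opprB opprK.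
  rewrite addrA subrr add0r normrZ normfV mulrC ler_pdivlMr ?normr_gt0//.
  by rewrite mulrC.
have [c yc cM] := sM _ ya; exists (fun i => oapp c a (unlift ord0 i)).
  rewrite big_ord_recl unlift_none /=; under eq_bigr do rewrite liftK.
  by rewrite -yc addrC subrK.
move=> i; case: (unlift ord0 i) => [j|] /=; last first.
  by rewrite (le_trans ale)// ler_wpM2r// lerDl.
apply: (@le_trans _ _ (N * `|y|)); last by rewrite ler_wpM2r// lerDr.
rewrite (le_trans (cM j))// -mulrA ler_wpM2l// mulrDl mul1r.
rewrite (le_trans (ler_normB _ _))// lerD2l normrZ mulrAC.
by rewrite ler_wpM2r.
Qed.

Lemma lspan_closed s : closed (lspan s).
Proof.
by have [M M0 sM] := bounded_coef_ex s; exact: (bounded_coef_closed M0 sM).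
Qed.

End spans_in_normed_spaces.

Section finite_rank_operators.
Variables (R : realType) (k : scalar_kind).
Local Notation K := (scalar_field R k).

Definition finite_rank (X Y : normedModType K) (f : blop X Y) : Prop :=
  exists s : seq Y, forall x, lspan s (f x).

Lemma finite_rank_compl (X Y Z : normedModType K) (g : blop Y Z)
  (f : blop X Y) : finite_rank f -> finite_rank (g \oB f).
Proof.
by move=> [s fs]; exists (map g s) => x; exact: (lspan_map g (fs x)).
Qed.

Lemma finite_rank_compr (X Y Z : normedModType K) (g : blop Y Z)
  (f : blop X Y) : finite_rank g -> finite_rank (g \oB f).
Proof. by move=> [s gs]; exists s => x; exact: gs. Qed.

(** The coordinates of the images of the unit ball are bounded. *)
Lemma finite_rank_compact (X Y : normedModType K) (f : blop X Y) :
  finite_rank f -> compact_op f.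
Proof.
move=> [s fs]; apply/compact_opP.
have [M M0 sM] := bounded_coef_ex s.
have [N N0 fN] := blop_bounded f.
have [C [cC _ sC]] := lspan_box_compact s (M * N).
exists C => // x x1; have [c xE cM] := sM _ (fs x); rewrite xE; apply: sC => i.
rewrite (le_trans (cM i))// ler_wpM2l// (le_trans (fN x))//.
by rewrite ler_piMr.
Qed.

Lemma finite_cover (X : normedModType K) (A : set X) (e : K) :
  compact A -> 0 < e -> exists s : seq X, (forall z, z \in s -> A z) /\
    forall y, A y -> exists2 z, z \in s & `|z - y| < e.
Proof.
rewrite compact_cover => cA e0.
have [||D DA AD] := cA X A (fun z => ball z e).
- by move=> z _; exact: ball_open.
- by move=> y Ay; exists y => //; exact: ballxx.
exists (finmap.enum_fset D); split=> [z zD|y /AD[z /= zD /normed_ballP zy]].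
  by have := DA _ zD; rewrite inE.
by exists z.
Qed.

(** As the fixed space [E] is closed, its unit ball lies in a compact subset of
    [E].  Cover this subset by finitely many balls of radius [1/2] centred in
    [E]: each point of the unit ball of [E] is then a centre plus half a point
    of that ball, so that iteration approximates it by the span of the centres
    to within [2^-n].  This span is closed, hence contains [E]. *)
Lemma compact_fixed_space (X : normedModType K) (f : blop X X) :
  compact_op f -> exists s, forall x, f x = x -> lspan s x.
Proof.
move=> /compact_opP[A cA fA].
pose E := [set x | f x = x].
have cE : closed E.
  (* The span of the empty list is the zero subspace, closed as any span. *)
  rewrite (_ : E = lspan [::] \o (fun x => f x - x)); last first.
    apply/funext => x; apply/propext; split; rewrite /E/=.
      by move=> ->; rewrite subrr.
    by move=> /subr0_eq.
  apply: preimage_closed; last exact: lspan_closed.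
  by move=> x _; apply: cvgB; [exact: blop_continuous|exact: cvg_id].
have [|s [sE Es]] := finite_cover (compact_closedI cA cE) (_ : 0 < 2^-1 :> K).
  by rewrite invr_gt0.
have approx n x : E x -> `|x| <= 1 ->
    exists2 y, lspan s y & `|x - y| <= 2^-1 ^+ n.
  elim: n x => [|n ih] x Ex x1.
    by exists 0; [exact: lspan0|rewrite subr0 expr0].
  have [|z zs zx] := Es x.
    by split=> //; rewrite -Ex; exact: fA.
  have [_ Ez] := sE _ zs.
  have [||y sy xy] := ih (2 *: (x - z)).
  - by rewrite /E/= linearZ/= linearB /= Ex Ez.
  - by rewrite normrZ distrC ger0_norm// mulrC -ler_pdivlMr// mul1r ltW.
  exists (z + 2^-1 *: y).
    by apply: lspanD; [exact: lspan_mem|exact: lspanZ].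
  have -> : x - (z + 2^-1 *: y) = 2^-1 *: (2 *: (x - z) - y).
    by rewrite scalerBr scalerA mulVf// scale1r opprD addrA.
  by rewrite normrZ ger0_norm ?invr_ge0// exprS ler_wpM2l// invr_ge0.
exists s => x Ex.
have ball1 y : E y -> `|y| <= 1 -> lspan s y.
  move=> Ey y1; apply: lspan_closed => B /nbhs_ballP[e /= e0 eB].
  have [n ne] : exists n, (2^-1 : K) ^+ n < e.
    exact: scalar_half_pow_lt.
  have [w sw yw] := approx n y Ey y1; exists w; split => //.
  by apply/eB/normed_ballP; rewrite (le_lt_trans yw).
have [->|x0] := eqVneq x 0; first exact: lspan0.
have nx0 : `|x| != 0 by rewrite normr_eq0.
rewrite -[x](scalerKV nx0); apply/lspanZ/ball1.
  by rewrite /E/= linearZ /= Ex.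
by rewrite normrZ normfV normr_id mulVf.
Qed.

End finite_rank_operators.

(** * The defect of two projections and multiplication operators *)

Section multiplication_algebra.
Variables (R : realType) (k : scalar_kind).
Local Notation K := (scalar_field R k).
Variables (E F G Z : completeNormedModType K).

Lemma lmul_comp (A : blop F G) (B : blop E F) :
  lmul Z A \oB lmul Z B = lmul Z (A \oB B).
Proof.
apply: blopP => c; have [f ->] := calkin_piP c.
rewrite -[LHS]/(lmul Z A (lmul Z B _)) !lmul_pi; congr calkin_pi.
exact: blopP.
Qed.

Lemma rmul_comp (A : blop E F) (B : blop F G) :
  rmul Z A \oB rmul Z B = rmul Z (B \oB A).
Proof.
apply: blopP => c; have [f ->] := calkin_piP c.
rewrite -[LHS]/(rmul Z A (rmul Z B _)) !rmul_pi; congr calkin_pi.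
exact: blopP.
Qed.

Lemma lmulD (A B : blop E F) : lmul Z A + lmul Z B = lmul Z (A + B).
Proof.
apply: blopP => c; have [f ->] := calkin_piP c.
by rewrite blopD !lmul_pi -calkin_piD; congr calkin_pi; exact: blopP.
Qed.

Lemma rmulD (A B : blop E F) : rmul Z A + rmul Z B = rmul Z (A + B).
Proof.
apply: blopP => c; have [f ->] := calkin_piP c.
rewrite blopD !rmul_pi -calkin_piD; congr calkin_pi.
by apply: blopP => x; rewrite blopD -[RHS]/(f (A x + B x)) linearD.
Qed.

Lemma lmul_compact_sub (A B : blop E F) :
  compact_op (A - B) -> lmul Z A = lmul Z B.
Proof.
move=> AB; apply: blopP => c; have [f ->] := calkin_piP c; rewrite !lmul_pi.
exact/calkin_pi_eq/(compact_op_compr f AB).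
Qed.

Lemma rmul_compact_sub (A B : blop E F) :
  compact_op (A - B) -> rmul Z A = rmul Z B.
Proof.
move=> AB; apply: blopP => c; have [f ->] := calkin_piP c; rewrite !rmul_pi.
apply/calkin_pi_eq; rewrite (_ : _ - _ = f \oB (A - B)).
  exact: compact_op_compl.
by apply: blopP => x; rewrite -[RHS]/(f (A x - B x)) linearB.
Qed.

End multiplication_algebra.

Section calkin_invertibility.
Variables (R : realType) (k : scalar_kind).
Local Notation K := (scalar_field R k).
Variable X : completeNormedModType K.
Implicit Types (P Q U V W : blop X X).

Definition calkin_inverse U V :=
  compact_op (U \oB V - blop_id X) /\ compact_op (V \oB U - blop_id X).

Lemma invertible_lmul U V Z : calkin_inverse U V -> invertible (lmul Z U).
Proof.
have l1 : lmul Z (blop_id X) = blop_id _.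
  apply: blopP => c; have [f ->] := calkin_piP c; rewrite lmul_pi.
  by congr calkin_pi; exact: blopP.
move=> [UV VU]; exists (lmul Z V); rewrite !lmul_comp -l1.
by split; exact: lmul_compact_sub.
Qed.

Lemma invertible_rmul U V Z : calkin_inverse U V -> invertible (rmul Z U).
Proof.
have r1 : rmul Z (blop_id X) = blop_id _.
  apply: blopP => c; have [f ->] := calkin_piP c; rewrite rmul_pi.
  by congr calkin_pi; exact: blopP.
move=> [UV VU]; exists (rmul Z V); rewrite !rmul_comp -r1.
by split; exact: rmul_compact_sub.
Qed.

Lemma invertible_eq0 (Y : normedModType K) (U : blop Y Y) y :
  invertible U -> U y = 0 -> y = 0.
Proof.
move=> [V [_ VU]] Uy; have <- : (V \oB U) y = y by rewrite VU.
by rewrite /= Uy linear0.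
Qed.

Lemma calkin_pi0P (Y Z : completeNormedModType K) (W : blop Y Z) :
  calkin_pi W = 0 <-> compact_op W.
Proof. by rewrite -(linear0 (@calkin_pi _ _ Y Z)) calkin_pi_eq subr0. Qed.

Lemma lmul_compact_cancel U W :
  invertible (lmul X U) -> compact_op (U \oB W) -> compact_op W.
Proof.
move=> iU UW; apply/calkin_pi0P/(invertible_eq0 iU).
by rewrite lmul_pi; apply/calkin_pi0P.
Qed.

Lemma rmul_compact_cancel U W :
  invertible (rmul X U) -> compact_op (W \oB U) -> compact_op W.
Proof.
move=> iU UW; apply/calkin_pi0P/(invertible_eq0 iU).
by rewrite rmul_pi; apply/calkin_pi0P.
Qed.

Definition defect P Q := (blop_id X - Q) \oB (blop_id X - P).

Lemma defectE P Q x : defect P Q x = x - P x - Q (x - P x).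
Proof. by []. Qed.

Section two_projections.
Variables P Q : blop X X.
Hypotheses (PP : P \oB P = P) (QQ : Q \oB Q = Q).
Hypothesis PQ : finite_rank (P \oB Q).

Let PPx x : P (P x) = P x.
Proof. exact: (congr1 (fun f : blop X X => f x) PP). Qed.
Let QQx x : Q (Q x) = Q x.
Proof. exact: (congr1 (fun f : blop X X => f x) QQ). Qed.

Let PD x y : P (x + y) = P x + P y. Proof. exact: linearD. Qed.
Let QD x y : Q (x + y) = Q x + Q y. Proof. exact: linearD. Qed.
Let PB x y : P (x - y) = P x - P y. Proof. exact: linearB. Qed.
Let QB x y : Q (x - y) = Q x - Q y. Proof. exact: linearB. Qed.

Let abel (x a e d : X) : a - d + e - x = - (x - a - e + d).
Proof.
by rewrite opprD !opprB [a - d + e]addrAC [LHS]addrAC [a + e]addrC !addrA.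
Qed.

(** In the quotient, [(p + q)(1 - qp) - 1] and [(1 - qp)(p + q) - 1] are both
    [-w], because [pq = 0]. *)
Lemma defect_calkin_inverse : compact_op (defect P Q) ->
  calkin_inverse (P + Q) (blop_id X - Q \oB P).
Proof.
move=> cW; split.
  rewrite (_ : _ - _ = - (defect P Q + P \oB Q \oB P)).
    apply/compact_opsP; rewrite rpredN; apply/rpredD/compact_opsP.
      exact/compact_opsP.
    exact/compact_op_compr/finite_rank_compact.
  apply: blopP => x.
  rewrite -[LHS]/(P (x - Q (P x)) + Q (x - Q (P x)) - x).
  rewrite -[RHS]/(- (x - P x - Q (x - P x) + P (Q (P x)))).
  by rewrite PB !QB QQx [LHS]abel.
rewrite (_ : _ - _ = - (defect P Q + Q \oB (P \oB Q))).
  apply/compact_opsP; rewrite rpredN; apply/rpredD/compact_opsP.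
    exact/compact_opsP.
  exact/compact_op_compl/finite_rank_compact.
apply: blopP => x.
rewrite -[LHS]/(P x + Q x - Q (P (P x + Q x)) - x).
rewrite -[RHS]/(- (x - P x - Q (x - P x) + Q (P (Q x)))).
by rewrite PD PPx QD QB -[RHS]abel opprD [- _ - _]addrC addrACA.
Qed.

(** [P + Q] agrees with [P] on the range of [1 - Q], and [P(1 - P) = 0]; only a
    term [PQ(1 - P)] is left. *)
Lemma compact_sum_defect : compact_op ((P + Q) \oB defect P Q).
Proof.
rewrite (_ : _ \oB _ = - (P \oB Q \oB (blop_id X - P))).
  apply/compact_opsP; rewrite rpredN.
  exact/compact_opsP/compact_op_compr/finite_rank_compact.
apply: blopP => x.
rewrite -[RHS]/(- P (Q (x - P x))).
have Py : P (x - P x) = 0 by rewrite PB PPx subrr.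
rewrite -[LHS]/(P (x - P x - Q (x - P x)) + Q (x - P x - Q (x - P x))).
by rewrite [P (_ - Q _)]PB Py [Q (_ - Q _)]QB QQx subrr addr0 sub0r.
Qed.

(** [1 - P] kills [P], and maps [Q] to [Q - PQ]; then [1 - Q] kills [Q]. *)
Lemma compact_defect_sum : compact_op (defect P Q \oB (P + Q)).
Proof.
rewrite (_ : _ \oB _ = - ((blop_id X - Q) \oB (P \oB Q))).
  apply/compact_opsP; rewrite rpredN.
  exact/compact_opsP/compact_op_compl/finite_rank_compact.
apply: blopP => x.
rewrite -[RHS]/(- (P (Q x) - Q (P (Q x)))).
rewrite -[LHS]/(P x + Q x - P (P x + Q x) - Q (P x + Q x - P (P x + Q x))).
have -> : P x + Q x - P (P x + Q x) = Q x - P (Q x).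
  by rewrite PD PPx opprD addrACA subrr add0r.
by rewrite QB QQx !opprB addrC addrA subrK.
Qed.

(** Up to a combination of finitely many vectors [u], every [x] is in the kernel
    of the finite-rank operator [W^2 - W], and then [W x] is a fixed point of
    [W]. *)
Lemma compact_defect_finite_rank :
  compact_op (defect P Q) -> finite_rank (defect P Q).
Proof.
move=> cW; set W := defect P Q.
have [t Et] := compact_fixed_space cW.
have [s sF] : finite_rank (W \oB W - W).
  rewrite (_ : _ - _ = (blop_id X - Q) \oB (P \oB Q) \oB (blop_id X - P)).
    exact/finite_rank_compr/finite_rank_compl.
  apply: blopP => x; set y := x - P x.
  have Py : P y = 0 by rewrite PB PPx subrr.
  rewrite -[LHS]/(defect P Q (y - Q y) - (y - Q y)) defectE.
  rewrite -[RHS]/(P (Q y) - Q (P (Q y))); move: y Py => y Py.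
  rewrite (_ : P (y - Q y) = - P (Q y)); last by rewrite PB Py sub0r.
  by rewrite opprK QD QB QQx subrr add0r addrAC [_ + P _]addrC addrK.
have [u [_ Fu]] := @lspan_preimage _ _ _ (W \oB W - W) s setT I
  (fun _ _ _ _ _ => I) (fun x _ => sF x).
exists (t ++ map W u) => x.
have [y uy Fxy] := Fu x I.
have fx : W (W (x - y)) = W (x - y).
  apply: subr0_eq; rewrite -[LHS]/((W \oB W - W) (x - y)).
  by rewrite linearB Fxy subrr.
rewrite -[x](subrK y) linearD; apply: lspanD.
  by apply: lspan_subset (Et _ fx) => z; rewrite mem_cat => ->.
apply: lspan_subset (lspan_map W uy) => z; by rewrite mem_cat orbC => ->.
Qed.

End two_projections.

End calkin_invertibility.

(** * Fredholm pairs *)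

Section sum_of_projections.
Variables (R : realType) (k : scalar_kind).
Local Notation K := (scalar_field R k).
Variable X : completeNormedModType K.
Variables P Q : blop X X.
Hypotheses (PP : P \oB P = P) (QQ : Q \oB Q = Q).
Hypothesis PQ : finite_rank (P \oB Q).

Lemma finite_rank_defect_lmul : finite_rank (defect P Q) <->
  forall Z : completeNormedModType K, invertible (lmul Z (P + Q)).
Proof.
split=> [/finite_rank_compact cW Z|/(_ X) iU].
  exact/invertible_lmul/(defect_calkin_inverse PP QQ PQ cW).
apply: (compact_defect_finite_rank PP QQ PQ).
exact/(lmul_compact_cancel iU)/compact_sum_defect.
Qed.

Lemma finite_rank_defect_rmul : finite_rank (defect P Q) <->
  forall Z : completeNormedModType K, invertible (rmul Z (P + Q)).
Proof.
split=> [/finite_rank_compact cW Z|/(_ X) iU].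
  exact/invertible_rmul/(defect_calkin_inverse PP QQ PQ cW).
apply: (compact_defect_finite_rank PP QQ PQ).
exact/(rmul_compact_cancel iU)/compact_defect_sum.
Qed.

End sum_of_projections.

Section half_of_a_pair.
Variables (R : realType) (k : scalar_kind).
Local Notation K := (scalar_field R k).

Lemma findim_range_finite_rank (X Y : normedModType K) (f : blop X Y) :
  findim (range f) -> finite_rank f.
Proof.
move=> /findim_quotientP[s [_ fs]]; exists s => x.
by have [|y sy /subr0_eq->] := fs (f x); first by exists x.
Qed.

Variables X Y : completeNormedModType K.
Variables (S : blop X Y) (T : blop Y X) (S' : blop Y X) (T' : blop X Y).
Hypotheses (SS' : generalized_inverse S S') (TT' : generalized_inverse T T').
Hypothesis ST : finite_rank (S \oB T).

(** The two conditions on subspaces of [X] in the definition of a Fredholm pair;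
    those on subspaces of [Y] are the same ones for the pair [(T, S)]. *)
Definition half_fredholm :=
  findim_quotient (null_space S) (null_space S `&` range T) /\
  findim_quotient (range T) (null_space S `&` range T).

Let SS'S x : S (S' (S x)) = S x.
Proof. by rewrite [in RHS]SS'. Qed.

Let TT'T y : T (T' (T y)) = T y.
Proof. by rewrite [in RHS]TT'. Qed.

Let null_space_linear a x y :
  null_space S x -> null_space S y -> null_space S (a *: x + y).
Proof.
move=> Sx Sy; rewrite /null_space /= linearP /= (_ : S x = 0)// (_ : S y = 0)//.
by rewrite scaler0 addr0.
Qed.

Let range_linear a x y : range T x -> range T y -> range T (a *: x + y).
Proof.
by move=> [v _ <-] [w _ <-]; exists (a *: v + w) => //; rewrite linearP.
Qed.

(** [W] is [1 - TT'] composed with the projection [1 - S'S] onto [N(S)], and the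
    kernel of [1 - TT'] is [R(T)]; so [W] has finite rank exactly when the
    first quotient is finite dimensional.  The second one is finite dimensional
    because [S] has finite rank on [R(T)]. *)
Lemma half_fredholmP :
  half_fredholm <-> finite_rank (defect (S' \oB S) (T \oB T')).
Proof.
split=> [[/findim_quotientP[s [_ NS]] _]|[s Ws]].
  exists (map (blop_id X - T \oB T') s) => x.
  have [|y sy [_ [z _ zE]]] := NS (x - S' (S x)).
    by rewrite /null_space/= linearB /= SS'S subrr.
  have -> : defect (S' \oB S) (T \oB T') x = (blop_id X - T \oB T') y.
    rewrite -[LHS]/((blop_id X - T \oB T') (x - S' (S x))).
    apply: subr0_eq; rewrite -linearB -zE -[LHS]/(T z - T (T' (T z))).
    by rewrite TT'T subrr.
  exact: lspan_map.
split; apply/findim_quotientP.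
  have [|a x y|x|t [tN Nt]] :=
      @lspan_preimage _ _ _ (blop_id X - T \oB T') s (null_space S).
  - by rewrite /null_space/= linear0.
  - exact: null_space_linear.
  - move=> Sx; rewrite (_ : _ x = defect (S' \oB S) (T \oB T') x).
      exact: Ws.
    rewrite -[RHS]/((blop_id X - T \oB T') (x - S' (S x))).
    by rewrite (_ : S x = 0)// linear0 subr0.
  exists t; split=> // x Nx; have [y ty xy] := Nt x Nx; exists y => //.
  have Sx : S x = 0 by [].
  have Sy : S y = 0.
    apply: (lspan_sub _ null_space_linear tN ty).
    by rewrite /null_space/= linear0.
  split; first by rewrite /null_space/= linearB /= Sx Sy subrr.
  exists (T' (x - y)) => //; apply/esym/subr0_eq.
  rewrite -[LHS]/((blop_id X - T \oB T') (x - y)).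
  by rewrite linearB xy subrr.
have [u SuT] := ST.
have [|a x y|x|t [tT Tt]] := @lspan_preimage _ _ _ S u (range T).
- by exists 0 => //; rewrite linear0.
- exact: range_linear.
- by move=> [v _ <-]; exact: SuT.
exists t; split=> // x Tx; have [y ty xy] := Tt x Tx; exists y => //.
split; first by rewrite /null_space/= linearB /= xy subrr.
have [v _ <-] := Tx.
have [w _ <-] : range T y.
  by apply: (lspan_sub _ range_linear tT ty); exists 0; rewrite ?linear0.
by exists (v - w) => //; rewrite linearB.
Qed.

Let PP : (S' \oB S) \oB (S' \oB S) = S' \oB S.
Proof. by apply: blopP => x /=; rewrite SS'S. Qed.

Let QQ : (T \oB T') \oB (T \oB T') = T \oB T'.
Proof. by apply: blopP => x /=; rewrite TT'T. Qed.

Let PQ : finite_rank ((S' \oB S) \oB (T \oB T')).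
Proof.
have [s fs] : finite_rank (S' \oB (S \oB T) \oB T').
  exact/finite_rank_compr/finite_rank_compl.
by exists s.
Qed.

Lemma half_fredholm_lmul : half_fredholm <->
  forall Z : completeNormedModType K,
    invertible (lmul Z S' \oB lmul Z S + lmul Z T \oB lmul Z T').
Proof.
rewrite half_fredholmP (finite_rank_defect_lmul PP QQ PQ).
by split=> iU Z; move: (iU Z); rewrite !lmul_comp lmulD.
Qed.

Lemma half_fredholm_rmul : half_fredholm <->
  forall Z : completeNormedModType K,
    invertible (rmul Z T' \oB rmul Z T + rmul Z S \oB rmul Z S').
Proof.
rewrite half_fredholmP (finite_rank_defect_rmul PP QQ PQ).
by split=> iU Z; move: (iU Z); rewrite !rmul_comp rmulD addrC.
Qed.

End half_of_a_pair.

Theorem theorem5p5 (R : realType) (k : scalar_kind)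
    (X Y : completeNormedModType (scalar_field R k))
    (S : blop X Y) (T : blop Y X) (S' : blop Y X) (T' : blop X Y) :
  regular S -> regular T ->
  findim (range (S \oB T)) -> findim (range (T \oB S)) ->
  generalized_inverse S S' -> generalized_inverse T T' ->
  (regular_fredholm_pair S T <->
    forall Z : completeNormedModType (scalar_field R k),
      invertible (lmul Z S' \oB lmul Z S + lmul Z T \oB lmul Z T') /\
      invertible (lmul Z T' \oB lmul Z T + lmul Z S \oB lmul Z S')) /\
  (regular_fredholm_pair S T <->
    forall Z : completeNormedModType (scalar_field R k),
      invertible (rmul Z S' \oB rmul Z S + rmul Z T \oB rmul Z T') /\
      invertible (rmul Z T' \oB rmul Z T + rmul Z S \oB rmul Z S')).
Proof.
move=> rS rT /findim_range_finite_rank ST /findim_range_finite_rank TS SS' TT'.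
have pairE :
    regular_fredholm_pair S T <-> half_fredholm S T /\ half_fredholm T S.
  split=> [[[NS RT NT RS] _ _]//|[[NS RT] [NT RS]]].
  by split.
have andE (A B : completeNormedModType (scalar_field R k) -> Prop) :
    (forall Z, A Z /\ B Z) <-> (forall Z, A Z) /\ (forall Z, B Z).
  by split=> [AB|[a b] Z]; [split=> Z; have [] := AB Z|split].
rewrite pairE !andE; split.
  by rewrite (half_fredholm_lmul SS' TT' ST) (half_fredholm_lmul TT' SS' TS).
rewrite (half_fredholm_rmul SS' TT' ST) (half_fredholm_rmul TT' SS' TS).
by split=> -[].
Qed.
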